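(* Let $q=2^t$ with $t$ a positive odd integer, let $\beta\in\mathbb{F}_{q^2}\setminus\mathbb{F}_q$ be a root of $x^2+x+1$, and for a positive integer $k$ let $M_k(x)=(x+\beta+1)^k+(x+\beta)^k$. Let $n,m$ be positive integers with $n\le 3(q-1)$ and $m\le q-1$. Then $$x^{n+3(q-1)+m(q+1)}M_{n+3(q-1)}(x^{q-1})\equiv x^{n+m(q+1)}M_n(x^{q-1})\pmod{x^{q^2}+x},$$ i.e. both sides define the same function on $\mathbb{F}_{q^2}$; and for every positive integer $m'$ with $m'\equiv m\pmod{q-1}$, $$x^{n+m(q+1)}M_n(x)\equiv x^{n+m'(q+1)}M_n(x)\pmod{x^{q^2}+x}.$$ *)

(* Defs.v *)
From mathcomp Require Import all_boot all_order all_algebra all_field.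
Set Implicit Arguments.
Unset Strict Implicit.
Unset Printing Implicit Defensive.
Import GRing.Theory.
Local Open Scope ring_scope.

Definition M (F : fieldType) (beta : F) (k : nat) : {poly F} :=
  ('X + (beta + 1)%:P) ^+ k + ('X + beta%:P) ^+ k.

Definition eqpmod (F : fieldType) (d p r : {poly F}) : Prop := d %| p - r.

(* Main.v *)
Require Import Defs.
From mathcomp Require Import all_boot all_order all_algebra all_field.
From mathcomp Require Import ring.
Set Implicit Arguments.
Unset Strict Implicit.
Unset Printing Implicit Defensive.
Import GRing.Theory.
Local Open Scope ring_scope.

(** For [c] one of [beta], [beta + 1], the factor [x^k] turns [(x^(q-1) + c)^k]
    into [A^k] with [A = x^q + c x].  Since [q] is an odd power of 2 and [beta]
    has order 3, [c^q = c^2], so the Frobenius map [y |-> y^q] sends [A] to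
    [c^2 A]; hence [A^(q-1)] is a cube root of unity unless [A = 0], and [A^k]
    with [k > 0] does not change when [k] grows by [3(q-1)]. *)

(** ['X^#|F| - 'X] is the product of the distinct linear factors ['X - a] over all [a] in [F], and
    each such [a] is a root of [p - r]. *)
Lemma dvdp_genPoly_of_eq_horner (F : finFieldType) (p r : {poly F}) :
  (forall x, p.[x] = r.[x]) -> ('X^#|F| - 'X) %| p - r.
Proof.
move=> epr; rewrite finField_genPoly -big_enum /= -(big_map id xpredT (fun a => 'X - a%:P)).
apply: uniq_roots_dvdp; last by rewrite map_id uniq_rootsE enum_uniq.
by apply/allP=> x _; rewrite rootE hornerD hornerN epr subrr.
Qed.

Lemma expf_eq_scale_add3 (F : fieldType) (q k : nat) (c y : F) :
  (0 < q)%N -> (0 < k)%N -> c ^+ 3 = 1 -> y ^+ q = c * y ->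
  y ^+ (k + 3 * (q - 1)) = y ^+ k.
Proof.
(* At [y = 0] both powers vanish because [k > 0]; elsewhere [y] can be cancelled from
   [y ^+ q = c * y]. *)
move=> q_gt0 k_gt0 c3 yq; have [-> | y0] := eqVneq y 0.
  by rewrite !expr0n addn_eq0 (gtn_eqF k_gt0).
have yq1 : y ^+ (q - 1) = c.
  by apply: (mulIf y0); rewrite -exprSr subn1 prednK.
by rewrite exprD (mulnC 3) exprM yq1 c3 mulr1.
Qed.

(** Writing [t = 2s + 1] gives [2 ^ t = 2 * 4 ^ s], which is 2 modulo 3 since 4 is 1 modulo 3. *)
Lemma expr_odd_pow2_cube1 (R : pzRingType) (t : nat) (c : R) :
  odd t -> c ^+ 3 = 1 -> c ^+ (2 ^ t) = c ^+ 2.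
Proof.
move=> t_odd c3; rewrite -(expr_mod _ c3); congr (_ ^+ _).
rewrite -(odd_double_half t) t_odd add1n expnS -mul2n expnM -modnMmr -modnXm.
by rewrite -[(2 ^ 2 %% 3)%N]/1%N exp1n.
Qed.

(** Raising to the power [q = 2 ^ t] is additive and [x ^+ (q ^ 2) = x] on [F], so the left side is
    [x + c ^+ 2 * x ^+ q]; factoring out [c ^+ 2] uses [c ^+ 3 = 1]. *)
Lemma Frobenius_affine (F : finFieldType) (t : nat) (c x : F) :
  2 \in [pchar F] -> odd t -> #|F| = ((2 ^ t) ^ 2)%N -> c ^+ 3 = 1 ->
  (x ^+ (2 ^ t) + c * x) ^+ (2 ^ t) = c ^+ 2 * (x ^+ (2 ^ t) + c * x).
Proof.
move=> F2 t_odd cardF c3.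
have pnat_q : [pchar F].-nat (2 ^ t)%N by rewrite pnatX pnatE // F2.
rewrite exprDn_pchar // exprMn (expr_odd_pow2_cube1 t_odd c3).
rewrite -exprM mulnn -cardF expf_card.
by rewrite mulrDr mulrA -exprSr c3 mul1r addrC.
Qed.

Lemma horner_homogM (F : fieldType) (beta x : F) (q k : nat) : (0 < q)%N ->
  x ^+ k * (M beta k \Po 'X^(q - 1)).[x] =
  (x ^+ q + (beta + 1) * x) ^+ k + (x ^+ q + beta * x) ^+ k.
Proof.
move=> q_gt0.
have xq : x * x ^+ (q - 1) = x ^+ q by rewrite -exprS subn1 prednK.
rewrite horner_comp hornerXn /M !hornerD !horner_exp !hornerD !hornerX !hornerC.
by rewrite mulrDr -!exprMn; congr (_ ^+ _ + _ ^+ _); rewrite mulrDr xq (mulrC x).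
Qed.

Lemma expf_modn_card (F : finFieldType) (x : F) (a b : nat) :
  (0 < a)%N -> (0 < b)%N -> a = b %[mod #|F|.-1] -> x ^+ a = x ^+ b.
Proof.
move=> a_gt0 b_gt0 eab; have [-> | x0] := eqVneq x 0.
  by rewrite !expr0n (gtn_eqF a_gt0) (gtn_eqF b_gt0).
have x1 : x ^+ #|F|.-1 = 1.
  apply: (mulIf x0).
  by rewrite -exprSr prednK ?expf_card ?mul1r // (ltn_trans _ (finNzRing_gt1 F)).
by rewrite -(expr_mod a x1) eab expr_mod.
Qed.

Theorem mainTheorem6
  (t q : nat) (ht0 : (0 < t)%N) (ht : odd t) (hq : q = (2 ^ t)%N)
  (F : finFieldType) (hF : #|F| = (q ^ 2)%N)
  (Fq : {set F}) (hFq : GRing.divring_closed Fq) (hFqq : #|Fq| = q)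
  (beta : F) (hbeta : beta \notin Fq)
  (hroot : root ('X^2 + 'X + 1 : {poly F}) beta)
  (n m : nat) (hn0 : (0 < n)%N) (hm0 : (0 < m)%N)
  (hn : (n <= 3 * (q - 1))%N) (hm : (m <= q - 1)%N) :
  (let lhs := 'X^(n + 3 * (q - 1) + m * (q + 1))
                * (M beta (n + 3 * (q - 1)) \Po 'X^(q - 1)) in
   let rhs := 'X^(n + m * (q + 1)) * (M beta n \Po 'X^(q - 1)) in
   eqpmod ('X^(q ^ 2) + 'X) lhs rhs /\ (forall x : F, lhs.[x] = rhs.[x]))
  /\
  (forall m' : nat, (0 < m')%N -> m' = m %[mod q - 1] ->
     eqpmod ('X^(q ^ 2) + 'X)
       ('X^(n + m * (q + 1)) * M beta n)
       ('X^(n + m' * (q + 1)) * M beta n)).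
Proof.
have q_gt0 : (0 < q)%N by rewrite hq expn_gt0.
have cardF : #|F| = (2 ^ (t * 2))%N by rewrite hF hq expnM.
have F2 : 2 \in [pchar F] by exact: card_finPcharP cardF _.
have genE : 'X^(q ^ 2) + 'X = 'X^#|F| - 'X :> {poly F}.
  rewrite hF; congr (_ + _); apply/esym/oppr_pchar2.
  by rewrite pchar_poly.
have b2 : beta ^+ 2 = - (beta + 1).
  apply/eqP; rewrite -addr_eq0 addrA; move: hroot.
  by rewrite rootE !hornerE.
have b3 : beta ^+ 3 = 1 by ring: b2.
have b13 : (beta + 1) ^+ 3 = 1.
  (* In characteristic 2, [beta + 1] is [beta ^+ 2], whose cube is [(beta ^+ 3) ^+ 2]. *)
  by rewrite -[beta + 1](oppr_pchar2 F2) -b2 -exprM mulnC exprM b3 expr1n.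
have affine_period (c x : F) k : (0 < k)%N -> c ^+ 3 = 1 ->
    (x ^+ q + c * x) ^+ (k + 3 * (q - 1)) = (x ^+ q + c * x) ^+ k.
  move=> k_gt0 c3; apply: (@expf_eq_scale_add3 F q k (c ^+ 2)) => //.
    by rewrite exprAC c3 expr1n.
  by rewrite hq; apply: Frobenius_affine; rewrite -?hq.
split=> [lhs rhs | m' m'_gt0 mm'].
  have lhs_rhs x : lhs.[x] = rhs.[x].
    (* The factor [x ^+ (m * (q + 1))] is moved to the end on both sides, so that the remaining
       power of [x] homogenizes [M]. *)
    rewrite !hornerM !hornerXn ![_ ^+ (_ + m * _)]exprD ![_ * x ^+ (m * _) * _]mulrAC.
    by rewrite !horner_homogM // !affine_period.
  by split=> //; rewrite /eqpmod genE; apply: dvdp_genPoly_of_eq_horner.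
rewrite /eqpmod genE; apply: dvdp_genPoly_of_eq_horner => x.
rewrite !hornerM !hornerXn; congr (_ * _).
apply: expf_modn_card; rewrite ?addn_gt0 ?hn0 //.
(* Since [q ^ 2 - 1 = (q - 1) * (q + 1)], multiplying the congruence of [m] and [m'] modulo [q - 1]
   by [q + 1] gives one modulo [#|F|.-1]. *)
have -> : #|F|.-1 = ((q - 1) * (q + 1))%N.
  by rewrite hF -subn1 -[X in (_ - X)%N](exp1n 2) subn_sqr.
by apply/eqP; rewrite eqn_modDl -!muln_modl mm'.
Qed.
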